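(* Let $R$ be a commutative ring, let $(A,\underline\sigma)$ be an $n$-twisted commutative $R$-algebra and let $x_1,\ldots,x_n$ be $\underline\sigma$-coordinates of Schwarz type for $A$ over $R$. Then there exists a unique $A$-linear homomorphism of $R$-algebras $$A[\underline T]_{\underline\sigma}\to\mathrm D_{A/R,\underline\sigma,\underline\partial},\qquad T_i\mapsto 1-(x_i-\sigma_i(x_i))\,\partial_i\quad(i=1,\ldots,n).$$ If the $\underline\sigma$-coordinates $x_1,\ldots,x_n$ are strong, this map is an isomorphism.
   Context: An $n$-twisted commutative $R$-algebra $(A,\underline\sigma)$ is a commutative $R$-algebra with $n$ pairwise commuting $R$-algebra endomorphisms $\sigma_1,\ldots,\sigma_n$. A $\sigma_i$-derivation of $A/R$ is an $R$-linear map $D:A\to A$ with $D(xy)=D(x)y+\sigma_i(x)D(y)$ for all $x,y\in A$; a $\underline\sigma$-derivation of $A/R$ is a finite sum $\sum_i D_i$ with $D_i$ a $\sigma_i$-derivation. Elements $x_1,\ldots,x_n\in A$ are $\underline\sigma$-coordinates for $A/R$ if (1) for each $i$ there is a unique $\sigma_i$-derivation $\partial_i$ of $A/R$ with $\partial_i(x_i)=1$ and $\partial_i(x_j)=0$ for $j\ne i$; and (2) every $\underline\sigma$-derivation $D$ of $A/R$ satisfies $D=\sum_{i=1}^n D(x_i)\partial_i$. They are of Schwarz type if $\partial_i\partial_j=\partial_j\partial_i$ for all $i,j$ and $\sigma_i\partial_j=\partial_j\sigma_i$ for $i\ne j$ (as endomorphisms of $A$). They are strong if $x_i-\sigma_i(x_i)\in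 A^\times$ for all $i$. $A[\underline T]_{\underline\sigma}$ (twisted polynomial ring) is the free left $A$-module on the monomials $T_1^{k_1}\cdots T_n^{k_n}$, $\underline k\in\mathbb N^n$, with the ring structure extending that of $A$ in which the $T_i$ commute with each other and $T_i z=\sigma_i(z)T_i$ for $z\in A$. $\mathrm D_{A/R,\underline\sigma,\underline\partial}$ (standard twisted Weyl algebra) is the unique $R$-algebra containing $A$ as a subalgebra which is a free left $A$-module on the monomials $\partial_1^{k_1}\cdots\partial_n^{k_n}$ in pairwise commuting generators, also denoted $\partial_1,\ldots,\partial_n$, subject to $\partial_i z=\partial_{A,i}(z)+\sigma_i(z)\partial_i$ for $z\in A$, where $\partial_{A,i}$ denotes the $\sigma_i$-derivation $\partial_i$ of $A$ from (1). *)

(* Defs.v *)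
From HB Require Import structures.
From mathcomp Require Import all_boot all_order all_algebra.
From mathcomp Require Import finmap.
From mathcomp.multinomials Require Import monalg.
Set Implicit Arguments.
Unset Strict Implicit.
Unset Printing Implicit Defensive.
Import GRing.Theory.
Local Open Scope ring_scope.

(* MathComp's [algType] excludes the zero ring.  So that the zero algebra is
   allowed, rings are [pzRingType]s, a commutative R-algebra is given by its
   structure morphism [eta : {rmorphism R -> A}] (r acts as multiplication by
   [eta r]), and a ring P containing A is given by [iota : {rmorphism A -> P}],
   its R-algebra structure being [iota \o eta]. *)

Definition twisted_algebra (R A : comPzRingType) (eta : {rmorphism R -> A})
    (n : nat) (sigma : 'I_n -> {rmorphism A -> A}) : Prop :=
  (forall i r, sigma i (eta r) = eta r) /\
  (forall i j z, sigma i (sigma j z) = sigma j (sigma i z)).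

Definition skew_derivation (R A : comPzRingType) (eta : {rmorphism R -> A})
    (s : A -> A) (D : A -> A) : Prop :=
  [/\ forall y z, D (y + z) = D y + D z,
      forall r z, D (eta r * z) = eta r * D z
    & forall y z, D (y * z) = D y * z + s y * D z].

(* One summand for each i suffices, the s-derivations being closed under
   addition for any given s. *)
Definition twisted_derivation (R A : comPzRingType) (eta : {rmorphism R -> A})
    (n : nat) (sigma : 'I_n -> {rmorphism A -> A}) (D : A -> A) : Prop :=
  exists Ds : 'I_n -> A -> A,
    (forall i, skew_derivation eta (sigma i) (Ds i)) /\
    (forall z, D z = \sum_(i < n) Ds i z).

Definition dual_derivation (R A : comPzRingType) (eta : {rmorphism R -> A})
    (n : nat) (sigma : 'I_n -> {rmorphism A -> A}) (x : 'I_n -> A)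
    (i : 'I_n) (D : A -> A) : Prop :=
  skew_derivation eta (sigma i) D /\ (forall j, D (x j) = (j == i)%:R).

(* x is a family of coordinates, and [partial i] is the derivation denoted
   partial_i, which x determines. *)
Definition twisted_coordinates (R A : comPzRingType) (eta : {rmorphism R -> A})
    (n : nat) (sigma : 'I_n -> {rmorphism A -> A}) (x : 'I_n -> A)
    (partial : 'I_n -> A -> A) : Prop :=
  [/\ forall i, dual_derivation eta sigma x i (partial i),
      forall i D, dual_derivation eta sigma x i D -> D =1 partial i
    & forall D, twisted_derivation eta sigma D ->
        forall z, D z = \sum_(i < n) D (x i) * partial i z].

Definition Schwarz_type (A : comPzRingType) (n : nat)
    (sigma : 'I_n -> {rmorphism A -> A}) (partial : 'I_n -> A -> A) : Prop :=
  (forall i j z, partial i (partial j z) = partial j (partial i z)) /\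
  (forall i j, i != j ->
     forall z, sigma i (partial j z) = partial j (sigma i z)).

Definition strong_coordinates (A : comPzRingType) (n : nat)
    (sigma : 'I_n -> {rmorphism A -> A}) (x : 'I_n -> A) : Prop :=
  forall i, exists y, y * (x i - sigma i (x i)) = 1.

Definition algebra_extension (R A : comPzRingType) (eta : {rmorphism R -> A})
    (P : pzRingType) (iota : {rmorphism A -> P}) : Prop :=
  injective iota /\
  (forall r u, iota (eta r) * u = u * iota (eta r)).

(* The canonical map to P from the free left A-module on the monomials
   t_1^(k_1) ... t_n^(k_n); [{malg A[K]}] is the type of finitely supported
   functions from K to A. *)
Definition monomial_expansion (A : comPzRingType) (P : pzRingType)
    (iota : {rmorphism A -> P}) (n : nat) (t : 'I_n -> P)
    (c : {malg A[{ffun 'I_n -> nat}]}) : P :=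
  \sum_(k <- msupp c) iota c@_k * \prod_(i < n) t i ^+ k i.

Definition twisted_polynomial_ring (R A : comPzRingType)
    (eta : {rmorphism R -> A}) (n : nat) (sigma : 'I_n -> {rmorphism A -> A})
    (P : pzRingType) (iota : {rmorphism A -> P}) (T : 'I_n -> P) : Prop :=
  [/\ algebra_extension eta iota,
      forall i j, T i * T j = T j * T i,
      forall i z, T i * iota z = iota (sigma i z) * T i
    & bijective (monomial_expansion iota T)].

Definition twisted_Weyl_algebra (R A : comPzRingType)
    (eta : {rmorphism R -> A}) (n : nat) (sigma : 'I_n -> {rmorphism A -> A})
    (partial : 'I_n -> A -> A)
    (W : pzRingType) (iota : {rmorphism A -> W}) (d : 'I_n -> W) : Prop :=
  [/\ algebra_extension eta iota,
      forall i j, d i * d j = d j * d i,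
      forall i z, d i * iota z = iota (partial i z) + iota (sigma i z) * d i
    & bijective (monomial_expansion iota d)].

Definition linear_algebra_hom (R A : comPzRingType) (eta : {rmorphism R -> A})
    (P Q : pzRingType) (iotaP : {rmorphism A -> P}) (iotaQ : {rmorphism A -> Q})
    (f : {rmorphism P -> Q}) : Prop :=
  (forall r u, f (iotaP (eta r) * u) = iotaQ (eta r) * f u) /\
  (forall a u, f (iotaP a * u) = iotaQ a * f u).

(* The rest of the file shows that the two rings exist, so that quantifying
   over all rings satisfying the two predicates is not vacuous. *)

Section FreeModule.
Variables (A : comPzRingType) (n : nat).
Local Notation K := {ffun 'I_n -> nat}.
Local Notation M := {malg A[K]}.

Lemma malg_additive_eq (V : zmodType) (f g : M -> V) :
    (forall u v, f (u + v) = f u + f v) ->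
    (forall u v, g (u + v) = g u + g v) ->
    (forall a k, f << a *g k >> = g << a *g k >>) ->
  f =1 g.
Proof.
move=> fD gD fg u; rewrite (monalgE u).
elim: (enum_fset (msupp u)) => [|k s IHs]; last first.
  by rewrite big_cons fD gD fg IHs.
rewrite big_nil.
have f0 : f 0 = 0 by apply: (addrI (f 0)); rewrite -fD !addr0.
by rewrite f0; apply: (addrI (g 0)); rewrite -gD !addr0.
Qed.

Definition malg_lift (V : zmodType) (F : K -> A -> V) (u : M) : V :=
  \sum_(k <- msupp u) F k u@_k.

Section Lift.
Variables (V : zmodType) (F : K -> A -> V).
Hypothesis FD : forall k a b, F k (a + b) = F k a + F k b.

Lemma malg_lift_wide (u : M) (S : {fset K}) :
  fsubset (msupp u) S -> malg_lift F u = \sum_(k <- S) F k u@_k.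
Proof.
have F0 k : F k 0 = 0 by apply: (addrI (F k 0)); rewrite -FD !addr0.
move=> sS; rewrite /malg_lift; symmetry.
rewrite (big_fsetID _ (mem (msupp u))) /=.
rewrite [X in _ + X]big1_fset ?addr0; last first.
  by move=> k; rewrite !inE /= => /andP[_ kN] _; rewrite mcoeff_outdom ?F0.
apply: eq_fbigl => k; rewrite !inE /=.
by apply/andP/idP => [[]|ku] //; split=> //; apply: (fsubsetP sS).
Qed.

Lemma malg_liftD (u v : M) :
  malg_lift F (u + v) = malg_lift F u + malg_lift F v.
Proof.
pose S := fsetU (msupp u) (msupp v).
rewrite (@malg_lift_wide (u + v) S) ?msuppD_le //.
rewrite (@malg_lift_wide u S) ?fsubsetUl //.
rewrite (@malg_lift_wide v S) ?fsubsetUr // -big_split /=.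
by apply: eq_bigr => k _; rewrite mcoeffD FD.
Qed.

Lemma malg_liftU a k : malg_lift F << a *g k >> = F k a.
Proof. by rewrite (malg_lift_wide msuppU_le) big_seq_fset1 mcoeffUU. Qed.
End Lift.
End FreeModule.

(* On the free left A-module, d_i acts by
   a T^k |-> delta_i(a) T^k + sigma_i(a) T^(k + e_i), and the product is
   u * v = sum_k u_k d^k(v). *)
Section SkewExtension.
Variables (R A : comPzRingType) (eta : {rmorphism R -> A}) (n : nat).
Variables (sigma : 'I_n -> {rmorphism A -> A}) (delta : 'I_n -> A -> A).
Hypothesis sigma_twisted : twisted_algebra eta sigma.
Hypothesis delta_skew : forall i, skew_derivation eta (sigma i) (delta i).
Hypothesis delta_Schwarz : Schwarz_type sigma delta.

Local Notation K := {ffun 'I_n -> nat}.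
Local Notation M := {malg A[K]}.

Let deltaD i y z : delta i (y + z) = delta i y + delta i z.
Proof. by case: (delta_skew i). Qed.

Let deltaM i y z : delta i (y * z) = delta i y * z + sigma i y * delta i z.
Proof. by case: (delta_skew i). Qed.

Let delta1 i : delta i 1 = 0.
Proof.
apply: (addrI (delta i 1)); rewrite addr0.
by rewrite -{3}[1](mulr1 1) deltaM rmorph1 mulr1 mul1r.
Qed.

Let delta_eta i r : delta i (eta r) = 0.
Proof.
by case: (delta_skew i) => _ dZ _; rewrite -[eta r]mulr1 dZ delta1 mulr0.
Qed.

Let bump i (k : K) : K := [ffun j => (i == j) + k j]%N.

Let bumpC i j k : bump i (bump j k) = bump j (bump i k).
Proof. by apply/ffunP => l; rewrite !ffunE addnCA. Qed.

Let dgen i k a : M := << delta i a *g k >> + << sigma i a *g bump i k >>.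
Let dgenD i k a b : dgen i k (a + b) = dgen i k a + dgen i k b.
Proof. by rewrite /dgen deltaD rmorphD !monalgUD addrACA. Qed.

Let d i : M -> M := locked (malg_lift (dgen i)).
Let dD i u v : d i (u + v) = d i u + d i v.
Proof. by rewrite /d -lock; apply: malg_liftD (dgenD i) u v. Qed.
Let dU i a k : d i << a *g k >> = dgen i k a.
Proof. by rewrite /d -lock; apply: malg_liftU (dgenD i) a k. Qed.

Let sc a : M -> M := locked (malg_lift (fun k b => << a * b *g k >> : M)).
Let scgenD a k b c :
  << a * (b + c) *g k >> = << a * b *g k >> + << a * c *g k >> :> M.
Proof. by rewrite mulrDr monalgUD. Qed.
Let scD a u v : sc a (u + v) = sc a u + sc a v.
Proof. by rewrite /sc -lock; apply: malg_liftD (scgenD a) u v. Qed.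
Let scU a b k : sc a << b *g k >> = << a * b *g k >>.
Proof. by rewrite /sc -lock; apply: malg_liftU (scgenD a) b k. Qed.
Let scDl a b u : sc (a + b) u = sc a u + sc b u.
Proof.
move: u; apply: malg_additive_eq => [u v|u v|c k]; rewrite ?scD ?scU.
- by [].
- by rewrite addrACA.
- by rewrite mulrDl monalgUD.
Qed.
Let scA a b u : sc (a * b) u = sc a (sc b u).
Proof.
move: u; apply: malg_additive_eq => [u v|u v|c k]; rewrite ?scD ?scU //.
by rewrite mulrA.
Qed.
Let sc1 u : sc 1 u = u.
Proof.
by move: u; apply: malg_additive_eq => [u v|u v|c k]; rewrite ?scD ?scU ?mul1r.
Qed.

Let dC i j u : d i (d j u) = d j (d i u).
Proof.
case: sigma_twisted => _ sC; case: delta_Schwarz => deC sdC.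
have [->//|ij] := eqVneq i j.
move: u; apply: malg_additive_eq => [u v|u v|a k].
- by rewrite !dD.
- by rewrite !dD.
rewrite 2!dU /dgen !dD !dU /dgen deC (sC i j) (bumpC i j) (sdC i j ij).
rewrite -(sdC j i); last by rewrite eq_sym.
by rewrite -!addrA; congr (_ + _); rewrite addrCA.
Qed.

Let dsc i a u : d i (sc a u) = sc (delta i a) u + sc (sigma i a) (d i u).
Proof.
move: u; apply: malg_additive_eq => [u v|u v|b k].
- by rewrite scD dD.
- by rewrite !(scD, dD) addrACA.
- rewrite !scU !dU /dgen scD !scU deltaM rmorphM monalgUD addrA.
  by [].
Qed.

Let dpow (k : K) (u : M) (s : seq 'I_n) : M :=
  foldr (fun i => iter (k i) (d i)) u s.

Let iterdD i m u v : iter m (d i) (u + v) = iter m (d i) u + iter m (d i) v.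
Proof. by elim: m => //= m ->; rewrite dD. Qed.

Let dpowD k u v s : dpow k (u + v) s = dpow k u s + dpow k v s.
Proof. by elim: s => //= i s ->; rewrite iterdD. Qed.

Let iterdC i j m p u :
  iter m (d i) (iter p (d j) u) = iter p (d j) (iter m (d i) u).
Proof.
have C1 q v : d i (iter q (d j) v) = iter q (d j) (d i v).
  by elim: q => //= q <-; rewrite dC.
by elim: m => [|m IHm] //; rewrite !iterS IHm C1.
Qed.

Let dpow_bump i k u s :
  dpow (bump i k) u s = iter (count_mem i s) (d i) (dpow k u s).
Proof.
elim: s => //= j s ->; rewrite iterdC ffunE [in RHS]iterD eq_sym.
have [->|_] := eqVneq j i; last by rewrite iterdC.
by rewrite iterD -/(iter 1 _ _) [in RHS]iterdC (iterdC i i _ 1).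
Qed.

Let dp k u := dpow k u (enum 'I_n).

Let count1 (i : 'I_n) : count_mem i (enum 'I_n) = 1%N.
Proof. by rewrite count_uniq_mem ?enum_uniq // mem_enum. Qed.

Let dpD k u v : dp k (u + v) = dp k u + dp k v.
Proof. exact: dpowD. Qed.

Let dp_bump i k u : dp (bump i k) u = d i (dp k u).
Proof. by rewrite /dp dpow_bump count1. Qed.

Let k0 : K := [ffun=> 0%N].

Let dp0 u : dp k0 u = u.
Proof. by rewrite /dp; elim: (enum _) => //= i s ->; rewrite ffunE. Qed.

Let dpU c k : (forall i, delta i c = 0) -> (forall i, sigma i c = c) ->
  dp k << c *g k0 >> = << c *g k >>.
Proof.
move=> dc sc0; rewrite /dp.
pose kk s : K := [ffun j => count_mem j s * k j]%N.
have -> : k = kk (enum 'I_n).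
  by apply/ffunP => j; rewrite ffunE count1 mul1n.
have -> : forall k', dpow k' << c *g k0 >> (enum 'I_n)
                     = << c *g [ffun j => count_mem j (enum 'I_n) * k' j]%N >>.
  move=> k'; elim: (enum 'I_n) => [|i s /= ->].
    by congr (<< _ *g _ >>); apply/ffunP => j; rewrite !ffunE.
  rewrite (_ : [ffun j => ((i == j) + count_mem j s) * k' j]%N
    = iter (k' i) (bump i) [ffun j => count_mem j s * k' j]%N).
    elim: (k' i) => //= m ->.
    by rewrite dU /dgen dc sc0 monalgU0 add0r.
  apply/ffunP => j; rewrite ffunE.
  have -> m (l : K) : iter m (bump i) l j = ((i == j) * m + l j)%N.
    elim: m => [|m IHm]; first by rewrite muln0.
    by rewrite iterS ffunE IHm mulnS addnA.
  rewrite ffunE mulnDl; have [->//|_] := eqVneq i j.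
  by rewrite !mul0n.
by congr (<< _ *g _ >>); apply/ffunP => j; rewrite !ffunE count1 !mul1n.
Qed.

Let mulm (u v : M) : M := locked (malg_lift (fun k a => sc a (dp k v))) u.
Let mulgenD v k a b : sc (a + b) (dp k v) = sc a (dp k v) + sc b (dp k v).
Proof. exact: scDl. Qed.
Let mulmDl : left_distributive mulm +%R.
Proof.
by move=> u1 u2 v; rewrite /mulm -!lock; apply: malg_liftD (mulgenD v) u1 u2.
Qed.
Let mulmU a k v : mulm << a *g k >> v = sc a (dp k v).
Proof. by rewrite /mulm -lock; apply: malg_liftU (mulgenD v) a k. Qed.
Let mulmDr : right_distributive mulm +%R.
Proof.
move=> u v w; move: u; apply: malg_additive_eq => [u1 u2|u1 u2|a k].
- by rewrite mulmDl.
- by rewrite !mulmDl addrACA.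
- by rewrite !mulmU dpD scD.
Qed.
Let mulm_sc a u v : mulm (sc a u) v = sc a (mulm u v).
Proof.
move: u; apply: malg_additive_eq => [u1 u2|u1 u2|b k].
- by rewrite scD mulmDl.
- by rewrite mulmDl scD.
- by rewrite scU !mulmU scA.
Qed.
Let mulm_d i u v : mulm (d i u) v = d i (mulm u v).
Proof.
move: u; apply: malg_additive_eq => [u1 u2|u1 u2|a k].
- by rewrite dD mulmDl.
- by rewrite mulmDl dD.
- by rewrite dU /dgen mulmDl !mulmU dsc dp_bump.
Qed.
Let mulm_dp k u v : mulm (dp k u) v = dp k (mulm u v).
Proof.
rewrite /dp; elim: (enum _) => //= i s <-.
by elim: (k i) => //= m IHm; rewrite mulm_d IHm.
Qed.
Let mulmA : associative mulm.
Proof.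
move=> u v w; move: u; apply: malg_additive_eq => [u1 u2|u1 u2|a k].
- by rewrite mulmDl.
- by rewrite !mulmDl.
- by rewrite !mulmU mulm_sc mulm_dp.
Qed.
Let onem : M := << 1 *g k0 >>.
Let mul1m : left_id onem mulm.
Proof. by move=> u; rewrite mulmU dp0 sc1. Qed.
Let dp1 k : dp k onem = << 1 *g k >>.
Proof. by apply: dpU => i; rewrite ?delta1 ?rmorph1. Qed.
Let mulm1 : right_id onem mulm.
Proof.
move=> u; move: u; apply: malg_additive_eq => [u v|//|a k].
- by rewrite mulmDl.
- by rewrite mulmU dp1 scU mulr1.
Qed.

Lemma skew_extension_exists :
  exists (P : pzRingType) (iota : {rmorphism A -> P}) (t : 'I_n -> P),
  [/\ algebra_extension eta iota,
      forall i j, t i * t j = t j * t i,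
      forall i z, t i * iota z = iota (delta i z) + iota (sigma i z) * t i
    & bijective (monomial_expansion iota t)].
Proof.
pose P : pzRingType := HB.pack M
  (GRing.Zmodule_isPzRing.Build M mulmA mul1m mulm1 mulmDl mulmDr).
pose io (a : A) : P := << a *g k0 >>.
have ioB : zmod_morphism io by move=> a b; apply: monalgUB.
have ioM : monoid_morphism io.
  by split=> // a b; rewrite [RHS]mulmU dp0 scU.
pose iota : {rmorphism A -> P} := HB.pack io
  (GRing.isZmodMorphism.Build A P io ioB)
  (GRing.isMonoidMorphism.Build A P io ioM).
pose t i : P := d i onem.
have tE i (u : P) : t i * u = d i u by rewrite [LHS]mulm_d mul1m.
have iE a (u : P) : iota a * u = sc a u by rewrite [LHS]mulmU dp0.
have expE : monomial_expansion iota t =1 id.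
  move=> c; rewrite /monomial_expansion [RHS]monalgE.
  apply: eq_bigr => k _; rewrite iE.
  have -> : \prod_(i < n) t i ^+ k i = dp k onem :> P.
    have -> : \prod_(i < n) t i ^+ k i = \prod_(i <- enum 'I_n) t i ^+ k i.
      by rewrite [enum _]enumT; apply: congr_big => //; rewrite [index_enum]unlock.
    rewrite /dp.
    elim: (enum _) => [|i s IHs]; first by rewrite big_nil.
    rewrite big_cons IHs /=; elim: (k i) => [|m IHm]; first by rewrite mul1r.
    by rewrite exprS -mulrA tE IHm.
  by rewrite dp1 scU mulr1.
exists P, iota, t; split.
- split=> [a b ab|r u].
    by have := congr1 (mcoeff k0) (ab : << a *g k0 >> = << b *g k0 >> :> M);
       rewrite !mcoeffUU.
  rewrite iE -[RHS]/(mulm u << eta r *g k0 >>).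
  move: u; apply: malg_additive_eq => [u v|u v|a k]; rewrite ?scD ?mulmDl //.
  rewrite mulmU dpU; first by rewrite !scU mulrC.
    by move=> i; apply: delta_eta.
  by case: sigma_twisted.
- by move=> i j; rewrite !tE dC.
- move=> i z; rewrite tE iE [LHS]dU /dgen; congr (_ + _).
  by rewrite /t dU /dgen delta1 rmorph1 monalgU0 add0r scU mulr1.
- by exists id => c; rewrite expE.
Qed.
End SkewExtension.

Lemma twisted_polynomial_ring_exists (R A : comPzRingType)
    (eta : {rmorphism R -> A}) (n : nat) (sigma : 'I_n -> {rmorphism A -> A}) :
  twisted_algebra eta sigma ->
  exists (P : pzRingType) (iota : {rmorphism A -> P}) (T : 'I_n -> P),
    twisted_polynomial_ring eta sigma iota T.
Proof.
move=> tw; have [||P [iota [T [ext TC Tz free]]]] :=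
  @skew_extension_exists R A eta n sigma (fun _ _ => 0) tw.
- by move=> i; split=> *; rewrite ?addr0 ?mulr0 ?mul0r ?addr0.
- by split=> // i j _ z; rewrite rmorph0.
exists P, iota, T; split=> // i z.
by rewrite Tz rmorph0 add0r.
Qed.

Lemma twisted_Weyl_algebra_exists (R A : comPzRingType)
    (eta : {rmorphism R -> A}) (n : nat) (sigma : 'I_n -> {rmorphism A -> A})
    (x : 'I_n -> A) (partial : 'I_n -> A -> A) :
  twisted_algebra eta sigma -> twisted_coordinates eta sigma x partial ->
  Schwarz_type sigma partial ->
  exists (W : pzRingType) (iota : {rmorphism A -> W}) (d : 'I_n -> W),
    twisted_Weyl_algebra eta sigma partial iota d.
Proof.
move=> tw [dual _ _] Sch; apply: skew_extension_exists => // i.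
by have [] := dual i.
Qed.

(* Main.v *)
Require Import Defs.
From HB Require Import structures.
From mathcomp Require Import all_boot all_order all_algebra.
From mathcomp.multinomials Require Import monalg.
Set Implicit Arguments.
Unset Strict Implicit.
Unset Printing Implicit Defensive.
Import GRing.Theory.
Local Open Scope ring_scope.

(** In a commutative algebra, expanding [D (y z) = D (z y)] for a
    sigma-derivation [D] gives [D y (z - sigma z) = D z (y - sigma y)].  Taking
    [D = partial_i] and [z = x_i], and writing [h_i = x_i - sigma_i x_i], yields
        [h_i partial_i(y) = y - sigma_i y],
    so [sigma_i = 1 - h_i partial_i] already as operators on [A], and [sigma_i]
    fixes [x_j] for [j <> i] (lemma [dual_derivationE]).

    Both rings are free over [A] on ordered monomials in commuting generators
    [t_i] with [t_i z = delta_i z + sigma_i z t_i], where [delta = 0] for the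
    twisted polynomials and [delta = partial] for the Weyl algebra.  Such a ring
    has the universal property that a homomorphism to an [A]-ring is the same
    as a family satisfying these relations there (lemmas
    [skew_relations_lift] and [skew_relations_hom_eq]).  The identity above
    turns the relations of one ring into those of the other:
    - in the Weyl algebra the elements [1 - h_i d_i] satisfy the relations of
      the [T_i]; they commute because, for [j <> i], [h_j] is fixed by [sigma_i]
      and killed by [partial_i], the latter since [partial_i] commutes with
      [sigma_j];
    - if every [h_i] has an inverse [y_i], then in the polynomial ring the
      elements [y_i (1 - T_i)] satisfy the relations of the [d_i].
    The two homomorphisms so obtained are inverse to each other, since their
    composites fix [A] and the generators. *)

(** * Free skew extensions *)

(** Allowing [delta = 0] lets one universal property serve for both rings, and
    hence for the homomorphisms in both directions. *)
Definition skew_relations (A : comPzRingType) (n : nat)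
    (sigma : 'I_n -> {rmorphism A -> A}) (delta : 'I_n -> A -> A)
    (P : pzRingType) (iota : {rmorphism A -> P}) (t : 'I_n -> P) : Prop :=
  (forall i j, t i * t j = t j * t i) /\
  (forall i z, t i * iota z = iota (delta i z) + iota (sigma i z) * t i).

Section Monomials.
Variables (A : comPzRingType) (n : nat).
Variables (P : pzRingType) (iota : {rmorphism A -> P}) (t : 'I_n -> P).
Local Notation K := {ffun 'I_n -> nat}.

Let term (k : K) (a : A) : P := iota a * \prod_(i < n) t i ^+ k i.

Let termD k a b : term k (a + b) = term k a + term k b.
Proof. by rewrite /term rmorphD mulrDl. Qed.

Lemma monomial_expansionD (b c : {malg A[K]}) :
  monomial_expansion iota t (b + c) =
  monomial_expansion iota t b + monomial_expansion iota t c.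
Proof. exact: (malg_liftD termD). Qed.

Lemma monomial_expansionU a (k : K) :
  monomial_expansion iota t << a *g k >> =
  iota a * \prod_(i < n) t i ^+ k i.
Proof. exact: (malg_liftU termD). Qed.

Lemma monomial_expansion_const a :
  monomial_expansion iota t << a *g [ffun=> 0%N] >> = iota a.
Proof.
by rewrite monomial_expansionU big1 ?mulr1 // => i _; rewrite ffunE expr0.
Qed.

Hypothesis tC : forall i j, t i * t j = t j * t i.

Lemma mul_monomial i (k : K) :
  t i * \prod_(j < n) t j ^+ k j =
  \prod_(j < n) t j ^+ [ffun l => (i == l) + k l]%N j.
Proof.
have tiC (F : 'I_n -> nat) s :
    GRing.comm (t i) (\prod_(j <- s) t j ^+ F j).
  by apply: commr_prod => j _; apply: commrX; apply: tC.
have /(_ (index_enum 'I_n)) -> s :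
    \prod_(j <- s) t j ^+ [ffun l => (i == l) + k l]%N j =
    t i ^+ count_mem i s * \prod_(j <- s) t j ^+ k j.
  elim: s => [|j s IHs]; first by rewrite !big_nil mulr1.
  rewrite !big_cons /= {}IHs ffunE eq_sym.
  have [->|_] := eqVneq j i.
    by rewrite !mulrA -!exprD addnAC.
  rewrite !add0n !mulrA; congr (_ * _).
  by apply/commrX/commr_sym/commrX.
by rewrite (count_uniq_mem _ (index_enum_uniq _)) mem_index_enum expr1.
Qed.

End Monomials.

Section Generation.
Variables (A : comPzRingType) (n : nat).
Variables (P : pzRingType) (iota : {rmorphism A -> P}) (t : 'I_n -> P).
Hypothesis t_span : bijective (monomial_expansion iota t).

Lemma generated_ind (S : P -> Prop) :
    (forall u v, S u -> S v -> S (u + v)) ->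
    (forall u v, S u -> S v -> S (u * v)) ->
    (forall a, S (iota a)) -> (forall i, S (t i)) ->
  forall u, S u.
Proof.
move=> SD SM Sa St u; have [c _ cK] := t_span; rewrite -(cK u).
have S0 : S 0 by rewrite -(rmorph0 iota).
have S1 : S 1 by rewrite -(rmorph1 iota).
apply: (big_ind S S0 SD) => k _; apply: (SM) => //.
apply: (big_ind S S1 (SM)) => i _.
by elim: (k i) => [|m IHm]; rewrite ?expr0 // exprS; apply: SM.
Qed.

Lemma skew_relations_hom_eq (Q : pzRingType) (f g : {rmorphism P -> Q}) :
  (forall a, f (iota a) = g (iota a)) -> (forall i, f (t i) = g (t i)) ->
  f =1 g.
Proof.
move=> fga fgt; apply: generated_ind => // u v fgu fgv.
  by rewrite !rmorphD fgu fgv.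
by rewrite !rmorphM fgu fgv.
Qed.

End Generation.

Section Lift.
Variables (A : comPzRingType) (n : nat).
Variables (sigma : 'I_n -> {rmorphism A -> A}) (delta : 'I_n -> A -> A).
Variables (P : pzRingType) (iotaP : {rmorphism A -> P}) (t : 'I_n -> P).
Variables (Q : pzRingType) (iotaQ : {rmorphism A -> Q}) (s : 'I_n -> Q).
Hypothesis t_rel : skew_relations sigma delta iotaP t.
Hypothesis t_free : bijective (monomial_expansion iotaP t).
Hypothesis s_rel : skew_relations sigma delta iotaQ s.

(** Freeness gives the map sending [a t^k] to [a s^k].  It commutes with left
    multiplication by [A] and by the generators, because the relations compute
    [t_i (a t^k)] and [s_i (a s^k)] in the same way; as these elements generate
    [P], it is multiplicative. *)
Lemma skew_relations_lift :
  exists f : {rmorphism P -> Q},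
    (forall a, f (iotaP a) = iotaQ a) /\ (forall i, f (t i) = s i).
Proof.
have [tC tz] := t_rel; have [sC sz] := s_rel.
have [c expK cK] := t_free.
pose f u := monomial_expansion iotaQ s (c u).
have fE b : f (monomial_expansion iotaP t b) = monomial_expansion iotaQ s b.
  by rewrite /f expK.
have fD u v : f (u + v) = f u + f v.
  by rewrite -(cK u) -(cK v) -monomial_expansionD !fE monomial_expansionD.
have fU a (k : {ffun 'I_n -> nat}) :
    f (iotaP a * \prod_i t i ^+ k i) = iotaQ a * \prod_i s i ^+ k i.
  by rewrite -!monomial_expansionU fE.
have fa a : f (iotaP a) = iotaQ a.
  by rewrite -(monomial_expansion_const iotaP t) fE monomial_expansion_const.
have faM a u : f (iotaP a * u) = iotaQ a * f u.
  rewrite -(cK u).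
  move: (c u); apply: malg_additive_eq => [b1 b2|b1 b2|b k].
  - by rewrite monomial_expansionD mulrDr fD.
  - by rewrite monomial_expansionD fD mulrDr.
  - by rewrite monomial_expansionU fU !mulrA -!rmorphM fU.
have ftM i u : f (t i * u) = s i * f u.
  rewrite -(cK u).
  move: (c u); apply: malg_additive_eq => [b1 b2|b1 b2|b k].
  - by rewrite monomial_expansionD mulrDr fD.
  - by rewrite monomial_expansionD fD mulrDr.
  - rewrite monomial_expansionU fU !mulrA tz sz !mulrDl fD -!mulrA.
    by rewrite !mul_monomial // !fU.
have f1 : f 1 = 1 by rewrite -(rmorph1 iotaP) fa rmorph1.
have f0 : f 0 = 0 by rewrite -(rmorph0 iotaP) fa rmorph0.
have ft i : f (t i) = s i by rewrite -[t i]mulr1 ftM f1 mulr1.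
have fM u v : f (u * v) = f u * f v.
  move: u v.
  apply: (generated_ind t_free) => [u1 u2 M1 M2 v|u1 u2 M1 M2 v|a v|i v].
  - by rewrite mulrDl !fD M1 M2 mulrDl.
  - by rewrite -mulrA !M1 M2 mulrA.
  - by rewrite faM fa.
  - by rewrite ftM ft.
have fB : zmod_morphism f.
  by move=> u v; apply: (addIr (f v)); rewrite -fD !subrK.
pose fm : {rmorphism P -> Q} := HB.pack f
  (GRing.isZmodMorphism.Build P Q f fB)
  (GRing.isMonoidMorphism.Build P Q f (conj f1 fM)).
by exists fm.
Qed.

End Lift.

(** * Coordinates *)

Section Coordinates.
Variables (R A : comPzRingType) (eta : {rmorphism R -> A}) (n : nat).
Variables (sigma : 'I_n -> {rmorphism A -> A}) (x : 'I_n -> A).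
Variables (partial : 'I_n -> A -> A).
Local Notation h i := (x i - sigma i (x i)).

(** The factors [y] and [z] can be exchanged because [A] is commutative. *)
Lemma skew_derivation_exchange (s D : A -> A) :
  skew_derivation eta s D ->
  forall y z, D y * (z - s z) = D z * (y - s y).
Proof.
case=> _ _ DM y z; have := DM z y; rewrite [z * y]mulrC DM => Dyz.
rewrite !mulrBr [D y * s z]mulrC [D z * s y]mulrC.
apply: (addIr (s z * D y + s y * D z)).
by rewrite addrA subrK Dyz [s z * _ + _]addrC addrA subrK.
Qed.

Hypothesis partial_dual : forall i, dual_derivation eta sigma x i (partial i).

Lemma dual_derivationE i z : (x i - sigma i (x i)) * partial i z = z - sigma i z.
Proof.
have [D_skew Dx] := partial_dual i.
by rewrite mulrC (skew_derivation_exchange D_skew) Dx eqxx mul1r.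
Qed.

Lemma coordinate_fixed i j : i != j -> sigma i (x j) = x j.
Proof.
move=> ij; have [_ Dx] := partial_dual i.
have := dual_derivationE i (x j); rewrite Dx eq_sym (negPf ij) mulr0.
by move/eqP; rewrite eq_sym subr_eq0 => /eqP.
Qed.

Hypothesis A_twisted : twisted_algebra eta sigma.

Lemma step_fixed i j : i != j -> sigma i (h j) = h j.
Proof.
by move=> ij; rewrite rmorphB A_twisted.2 coordinate_fixed.
Qed.

Lemma step_inverse_fixed i j y :
  i != j -> y * h j = 1 -> sigma i y = y.
Proof.
move=> ij yh; rewrite -[LHS]mulr1 -yh mulrCA -(step_fixed ij).
by rewrite -rmorphM yh rmorph1 mulr1.
Qed.

Hypothesis x_Schwarz : Schwarz_type sigma partial.

Lemma partial_step i j : i != j -> partial i (h j) = 0.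
Proof.
move=> ij; have [[DD _ _] Dx] := partial_dual i.
have [_ sD] := x_Schwarz.
have Dxj : partial i (x j) = 0 by rewrite Dx eq_sym (negPf ij).
have : partial i (h j + sigma j (x j)) = 0 by rewrite subrK.
by rewrite DD -(sD j i) ?(eq_sym j) // Dxj rmorph0 addr0.
Qed.

(** The elements of the Weyl algebra that realise the relations of the twisted
    polynomial ring: the operators [sigma_i] written as [1 - h_i d_i]. *)
Lemma Weyl_twist_relations (W : pzRingType) (iota : {rmorphism A -> W})
    (d : 'I_n -> W) :
  skew_relations sigma partial iota d ->
  skew_relations sigma (fun _ _ => 0) iota (fun i => 1 - iota (h i) * d i).
Proof.
move=> [dC dz]; split=> [i j|i z]; last first.
  rewrite rmorph0 add0r mulrBl mul1r -mulrA dz mulrDr !mulrA -!rmorphM.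
  rewrite dual_derivationE rmorphB opprD opprB addrA subrKC.
  by rewrite [_ * sigma i z]mulrC rmorphM mulrBr mulr1 -mulrA.
have [->//|ij] := eqVneq i j.
have dh k l : k != l -> d k * iota (h l) = iota (h l) * d k.
  by move=> kl; rewrite dz partial_step // step_fixed // rmorph0 add0r.
have hdC : GRing.comm (iota (h i) * d i) (iota (h j) * d j).
  rewrite /GRing.comm -!mulrA [d i * _]mulrA dh // [d j * _]mulrA.
  rewrite (dh j i) 1?eq_sym // -!mulrA dC !mulrA; congr (_ * _ * _).
  by rewrite -!rmorphM mulrC.
have hd1 k : GRing.comm (iota (h k) * d k) 1 by apply: commr1.
rewrite -/(GRing.comm _ _).
apply: commrB; first exact: commr1.
apply/commr_sym/commrB; first exact: commr1.
exact/commr_sym.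
Qed.

(** Conversely, [h_i^-1 (1 - T_i)] is the difference quotient that
    [partial_i = h_i^-1 (1 - sigma_i)] is on [A]. *)
Lemma twist_quotient_relations (P : pzRingType) (iota : {rmorphism A -> P})
    (T : 'I_n -> P) (y : 'I_n -> A) :
  (forall i, y i * h i = 1) ->
  skew_relations sigma (fun _ _ => 0) iota T ->
  skew_relations sigma partial iota (fun i => iota (y i) * (1 - T i)).
Proof.
move=> yh [TC T0z].
have Tz i z : T i * iota z = iota (sigma i z) * T i.
  by rewrite T0z rmorph0 add0r.
split=> [i j|i z]; last first.
  have -> : partial i z = y i * (z - sigma i z).
    by rewrite -dual_derivationE mulrA yh mul1r.
  rewrite -mulrA mulrBl mul1r Tz [RHS]addrC mulrA -rmorphM.
  rewrite [sigma i z * y i]mulrC !rmorphM -mulrA -mulrDr; congr (_ * _).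
  by rewrite mulrBr mulr1 rmorphB [RHS]addrC addrA subrK.
have [->//|ij] := eqVneq i j.
have Ty k l : k != l -> GRing.comm (1 - T k) (iota (y l)).
  move=> kl; apply/commr_sym/commrB; first exact: commr1.
  by rewrite /GRing.comm Tz (step_inverse_fixed kl (yh l)).
have TT : GRing.comm (1 - T i) (1 - T j).
  apply/commrB; first exact: commr1.
  by apply/commr_sym/commrB; [exact: commr1 | exact: TC].
rewrite -!mulrA [(1 - T i) * _]mulrA Ty // [(1 - T j) * _]mulrA.
rewrite (Ty j i) 1?eq_sym // -!mulrA TT !mulrA; congr (_ * _ * _).
by rewrite -!rmorphM mulrC.
Qed.

End Coordinates.

(** * The comparison homomorphism *)

Lemma linear_algebra_homP (R A : comPzRingType) (eta : {rmorphism R -> A})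
    (P Q : pzRingType) (iotaP : {rmorphism A -> P}) (iotaQ : {rmorphism A -> Q})
    (f : {rmorphism P -> Q}) :
  linear_algebra_hom eta iotaP iotaQ f <-> forall a, f (iotaP a) = iotaQ a.
Proof.
split=> [[_ fl] a|fa]; last by split=> a u; rewrite rmorphM fa.
by rewrite -[iotaP a]mulr1 fl rmorph1 mulr1.
Qed.

Theorem theorem6p13 (R A : comPzRingType) (eta : {rmorphism R -> A}) (n : nat)
    (sigma : 'I_n -> {rmorphism A -> A}) (x : 'I_n -> A)
    (partial : 'I_n -> A -> A)
    (P : pzRingType) (iotaP : {rmorphism A -> P}) (T : 'I_n -> P)
    (W : pzRingType) (iotaW : {rmorphism A -> W}) (d : 'I_n -> W)
    (A_twisted : twisted_algebra eta sigma)
    (x_coordinates : twisted_coordinates eta sigma x partial)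
    (x_Schwarz : Schwarz_type sigma partial)
    (P_def : twisted_polynomial_ring eta sigma iotaP T)
    (W_def : twisted_Weyl_algebra eta sigma partial iotaW d) :
  exists f : {rmorphism P -> W},
    [/\ linear_algebra_hom eta iotaP iotaW f /\
          (forall i, f (T i) = 1 - iotaW (x i - sigma i (x i)) * d i),
        forall g : {rmorphism P -> W},
          linear_algebra_hom eta iotaP iotaW g ->
          (forall i, g (T i) = 1 - iotaW (x i - sigma i (x i)) * d i) ->
          g =1 f
      & strong_coordinates sigma x -> bijective f].
Proof.
have [x_dual _ _] := x_coordinates.
have [_ TC Tz T_free] := P_def; have [_ dC dz d_free] := W_def.
have T_rel : skew_relations sigma (fun _ _ => 0) iotaP T.
  by split=> // i z; rewrite rmorph0 add0r.
have d_rel : skew_relations sigma partial iotaW d by split.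
have [f [fa fT]] := skew_relations_lift T_rel T_free
  (Weyl_twist_relations x_dual A_twisted x_Schwarz d_rel).
exists f; split; first by split=> //; apply/linear_algebra_homP.
  move=> g /linear_algebra_homP ga gT.
  by apply: (skew_relations_hom_eq T_free) => [a|i]; rewrite ?ga ?gT ?fa ?fT.
move=> x_strong.
have [y yh] := fin_all_exists x_strong.
have [g [ga gd]] := skew_relations_lift d_rel d_free
  (twist_quotient_relations x_dual A_twisted yh T_rel).
exists g => u.
  apply: (skew_relations_hom_eq T_free (f := g \o f) (g := idfun)) => [a|i] /=.
    by rewrite fa ga.
  rewrite fT rmorphB rmorph1 rmorphM ga gd mulrA -rmorphM.
  by rewrite [_ * y i]mulrC yh rmorph1 mul1r subKr.
apply: (skew_relations_hom_eq d_free (f := f \o g) (g := idfun)) => [a|i] /=.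
  by rewrite ga fa.
rewrite gd rmorphM rmorphB rmorph1 fa fT subKr mulrA -rmorphM.
by rewrite yh rmorph1 mul1r.
Qed.
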